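(* Let $\phi:H\to G$ be a virtual endomorphism of a group $G$ (a homomorphism from a subgroup $H<G$ of finite index). Let $(G,X^* )$ and $(G,Y^* )$ be contracting self-similar actions defined respectively by the triples $(\phi,T,C)$ and $(\phi,T',C')$, where $T=\{g_x\}_{x\in X}$, $T'=\{g'_y\}_{y\in Y}$ are left coset transversals of $H$ in $G$ and $C=\{h_x\}_{x\in X}$, $C'=\{h'_y\}_{y\in Y}$ are families of elements of $G$. Let $\alpha:\mathcal{X}_{(G,X^* )}\to\mathcal{X}_{(G,Y^* )}$ be the $G$-equivariant homeomorphism of the limit $G$-spaces satisfying $$\alpha(\tau_x(t))=\tau_y(\alpha(t))\cdot s_x\qquad\text{for all } t\in\mathcal{X}_{(G,X^* )},\ x\in X,$$ where $y\in Y$ is the letter with ${g'_y}^{-1}g_x\in H$ and $s_x={h'_y}^{-1}\phi({g'_y}^{-1}g_x)h_x$. Then $\alpha$ preserves measure, i.e. $$\mu_{(G,Y^* )}(\alpha(A))=\mu_{(G,X^* )}(A)$$ for any Borel set $A\subseteq\mathcal{X}_{(G,X^* )}$.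
   Context: Let $X$ be a finite nonempty set, $X^*$ the set of finite words over $X$, and $X^{-\omega}$ the space of left-infinite sequences $\ldots x_2x_1$, $x_i\in X$, with the product topology. A faithful (left) action of a group $G$ on $X^*$ is self-similar if for every $g\in G$, $x\in X$ there exist $h\in G$, $y\in X$ such that $g(xw)=y\,h(w)$ for all $w\in X^*$; then $h$ is denoted $g|_x$, and $g|_{x_1\ldots x_n}=g|_{x_1}|_{x_2}\cdots|_{x_n}$. The action is contracting if there is a finite set $\mathcal{N}\subset G$ such that for every $g\in G$ there is $k$ with $g|_v\in\mathcal{N}$ for all words $v$ of length $\ge k$. The action defined by $(\phi,T,C)$, where $\phi:H\to G$ with $[G:H]=|X|$, $T=\{g_x\}_{x\in X}$ is a left coset transversal for $H$ and $C=\{h_x\}_{x\in X}\subset G$, is given by $g(x)=x'$ and $g|_x=h_{x'}^{-1}\phi(g_{x'}^{-1}gg_x)h_x$, where $x'\in X$ is the unique letter with $g_{x'}^{-1}gg_x\in H$. Two elements $\ldots x_2x_1\cdot g$ and $\ldots y_2y_1\cdot h$ of $X^{-\omega}\times G$ ($G$ discrete) are asymptotically equivalent if there are a finite set $K\subset G$ and $g_n\in K$, $n\ge1$, with $g_n(x_n\ldots x_1)=y_n\ldots y_1$ and $g_n|_{x_n\ldots x_1}\cdot g=h$ for all $n\ge 1$. The limit $G$-space $\mathcal{X}_{(G,X^* )}$ is the quotient topological space of $X^{-\omega}\times G$ by this relation; $G$ acts on it from the right by multiplication on the $G$-coordinate. For $x\in X$ the map $\tau_x$ given by $\tau_x(\ldots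 x_2x_1\cdot g)=\ldots x_2x_1g(x)\cdot g|_x$ is a well-defined continuous self-map of $\mathcal{X}_{(G,X^* )}$. The measure $\mu_{(G,X^* )}$ on $\mathcal{X}_{(G,X^* )}$ is the push-forward, under the quotient map, of the product of the uniform Bernoulli measure on $X^{-\omega}$ (each letter has weight $1/|X|$) and the counting measure on $G$. The same definitions are used for $Y$. A homeomorphism $\alpha$ as in the claim is known to exist. *)

(* Defs.v *)
From HB Require Import structures.
From mathcomp Require Import all_boot all_order all_algebra.
From mathcomp Require Import generic_quotient.
From mathcomp Require Import all_classical all_reals all_analysis.
From mathcomp Require Import measurable_realfun.

Set Implicit Arguments.
Unset Strict Implicit.
Unset Printing Implicit Defensive.

Import Order.TTheory GRing.Theory Num.Theory.
Import numFieldNormedType.Exports.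

Local Open Scope classical_set_scope.
Local Open Scope quotient_scope.
Local Open Scope group_scope.

(* A finite nonempty set.  The distinguished letter only witnesses
   nonemptiness, in the form the measurable-space library requires. *)
#[short(type="alphabetType")]
HB.structure Definition Alphabet := {X of Finite X & isPointed X}.

(* X^{-omega}: the left-infinite sequence ... x_2 x_1 is the function sending
   i to x_{i+1}. *)
Definition word_space (X : Type) : Type :=
  prod_topology (fun _ : nat => discrete_topology X).

HB.instance Definition _ (X : alphabetType) := Pointed.on (word_space X).
HB.instance Definition _ (X : alphabetType) := Topological.on (word_space X).

Definition discrete_group (G : Type) : Type := G.
HB.instance Definition _ (G : groupType) := Choice.copy (discrete_group G) G.
HB.instance Definition _ (G : groupType) :=
  isPointed.Build (discrete_group G) (1 : G).
HB.instance Definition _ (G : groupType) :=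
  Topological.copy (discrete_group G) (discrete_topology G).
HB.instance Definition _ (G : groupType) :=
  @isMeasurable.Build default_measure_display
    (discrete_group G) discrete_measurable discrete_measurable0
    discrete_measurableC discrete_measurableU.

(* phi is a total function on G, but it is a homomorphism only on its domain,
   and is only ever evaluated there. *)
Record virtual_endomorphism (G : groupType) := VirtualEndomorphism {
  ve_dom : groupClosed G;
  ve_fun :> G -> G;
  ve_morph : {in ve_dom &, {morph ve_fun : a b / a * b}};
  ve_finite_index :
    exists r : seq G, forall g, exists2 a, a \in r & a^-1 * g \in ve_dom }.

Definition left_transversal (G : groupType) (X : Type) (H : groupClosed G)
  (T : X -> G) := forall g : G, exists! x : X, (T x)^-1 * g \in H.

(* A finite word x_1 ... x_n is the list [:: x_1; ...; x_n].  ss_letter g x is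
   g(x) and ss_rest g x is g|_x; by ss_faithful both are determined by the
   action, so they are not extra data. *)
Record self_similar_action (G : groupType) (X : Type) := SelfSimilarAction {
  ss_act :> G -> seq X -> seq X;
  ss_act1 : forall w, ss_act 1 w = w;
  ss_actM : forall g h w, ss_act (g * h) w = ss_act g (ss_act h w);
  ss_faithful : forall g h, ss_act g =1 ss_act h -> g = h;
  ss_letter : G -> X -> X;
  ss_rest : G -> X -> G;
  ss_actE : forall g x w,
    ss_act g (x :: w) = ss_letter g x :: ss_act (ss_rest g x) w }.

Section self_similar_theory.
Context (G : groupType) (X : Type) (S : self_similar_action G X).
Implicit Types (g h : G) (x : X) (v w : seq X).

Definition ss_section g v : G := foldl (ss_rest S) g v.

Definition contracting := exists2 N : set G, finite_set N &
  forall g, exists k, forall v, (k <= size v)%N -> N (ss_section g v).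

Definition defined_by (phi : virtual_endomorphism G) (T C : X -> G) :=
  forall g x, let x' := ss_letter S g x in
    (T x')^-1 * g * T x \in ve_dom phi /\
    ss_rest S g x = (C x')^-1 * phi ((T x')^-1 * g * T x) * C x.

Lemma ss_act_nil g : S g [::] = [::].
Proof.
case E : (S g [::]) => [//|x w].
have := ss_act1 S [::]; rewrite -(mulVg g) ss_actM E ss_actE; done.
Qed.

Lemma ss_letterM g h x : ss_letter S (g * h) x = ss_letter S g (ss_letter S h x).
Proof. by have := ss_actM S g h [:: x]; rewrite !ss_actE; case. Qed.

Lemma ss_restM g h x :
  ss_rest S (g * h) x = ss_rest S g (ss_letter S h x) * ss_rest S h x.
Proof.
apply: (@ss_faithful _ _ S) => w.
by have := ss_actM S g h (x :: w); rewrite !ss_actE => -[_ ->]; rewrite ss_actM.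
Qed.

Lemma ss_rest1 x : ss_rest S 1 x = 1.
Proof.
apply: (@ss_faithful _ _ S) => w; rewrite ss_act1.
by have := ss_act1 S (x :: w); rewrite ss_actE => -[].
Qed.

Lemma ss_sectionM g h v :
  ss_section (g * h) v = ss_section g (S h v) * ss_section h v.
Proof.
elim: v g h => [|x v IH] g h /=; first by rewrite ss_act_nil.
by rewrite /ss_section/= ss_actE/= ss_restM; exact: IH.
Qed.

Lemma ss_section1 v : ss_section 1 v = 1.
Proof. by elim: v => [//|x v IH]; rewrite /ss_section /= ss_rest1. Qed.

Lemma ss_act_cat g v w : S g (v ++ w) = S g v ++ S (ss_section g v) w.
Proof.
elim: v g => [|x v IH] g; first by rewrite ss_act_nil.
by rewrite cat_cons !ss_actE IH.
Qed.

Lemma ss_section_rcons g v x :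
  ss_section g (rcons v x) = ss_rest S (ss_section g v) x.
Proof. by rewrite /ss_section foldl_rcons. Qed.

Lemma ss_act_rcons g v x :
  S g (rcons v x) = rcons (S g v) (ss_letter S (ss_section g v) x).
Proof. by rewrite -!cats1 ss_act_cat ss_actE ss_act_nil. Qed.

End self_similar_theory.

(* The word x_n ... x_1 for w = ... x_2 x_1. *)
Definition ending (X : Type) (w : word_space X) (n : nat) : seq X :=
  rev (mkseq w n).

(* ... x_2 x_1 x *)
Definition append (X : Type) (w : word_space X) (x : X) : word_space X :=
  fun n => if n is m.+1 then w m else x.

Lemma ending_append (X : Type) (w : word_space X) x n :
  ending (append w x) n.+1 = rcons (ending w n) x.
Proof.
rewrite /ending /mkseq /= rev_cons; congr (rcons (rev _) _).
by rewrite -[1%N]/(1 + 0)%N iotaDl -map_comp.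
Qed.

Section limit_space.
Context (G : groupType) (X : alphabetType) (S : self_similar_action G X).

Definition marked_words : Type := (word_space X * discrete_group G)%type.
HB.instance Definition _ := Topological.on marked_words.
HB.instance Definition _ := Pointed.on marked_words.

Definition asymptotic (p q : marked_words) : Prop :=
  exists2 K : set G, finite_set K & exists gs : nat -> G,
    forall n, (0 < n)%N ->
      [/\ K (gs n),
          S (gs n) (ending p.1 n) = ending q.1 n &
          ss_section S (gs n) (ending p.1 n) * (p.2 : G) = q.2].

Definition asymptoticb : rel marked_words := fun p q => `[< asymptotic p q >].

Lemma asymptotic_refl : reflexive asymptoticb.
Proof.
move=> p; apply/asboolP; exists [set 1]; first exact: finite_set1.
by exists (fun=> 1) => n _; split => //; rewrite ?ss_act1// ss_section1 mul1g.
Qed.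

Lemma asymptotic_imp p q : asymptotic p q -> asymptotic q p.
Proof.
move=> [K finK [gs gsP]]; exists [set a^-1 | a in K]; first exact: finite_image.
exists (fun n => (gs n)^-1) => n n0; have [Kn actn secn] := gsP n n0.
split; first by exists (gs n).
- by rewrite -actn -ss_actM mulVg ss_act1.
- rewrite -secn mulgA -actn -ss_sectionM mulVg ss_section1.
  exact: mul1g.
Qed.

Lemma asymptotic_sym : symmetric asymptoticb.
Proof. by move=> p q; apply/asboolP/asboolP; exact: asymptotic_imp. Qed.

Lemma asymptotic_trans : transitive asymptoticb.
Proof.
move=> q p r /asboolP[K finK [gs gsP]] /asboolP[L finL [hs hsP]].
apply/asboolP; exists [set a * b | a in L & b in K].
  exact: finite_image2.
exists (fun n => hs n * gs n) => n n0.
have [Kn actn secn] := gsP n n0; have [Ln bctn tecn] := hsP n n0.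
split; first by exists (hs n) => //; exists (gs n).
- by rewrite ss_actM actn.
- by rewrite ss_sectionM actn -mulgA secn.
Qed.

Definition asymptotic_equiv : equiv_rel marked_words :=
  EquivRel asymptoticb asymptotic_refl asymptotic_sym asymptotic_trans.

Definition limit_space : Type := quotient_topology {eq_quot asymptotic_equiv}.

HB.instance Definition _ := Topological.on limit_space.
HB.instance Definition _ := Quotient.on limit_space.
HB.instance Definition _ :=
  isPointed.Build limit_space (\pi_limit_space (point : marked_words)).

Definition limit_pi (p : marked_words) : limit_space := \pi_limit_space p.

Lemma limit_piP p q : limit_pi p = limit_pi q <-> asymptotic p q.
Proof.
split=> [/eqmodP/asboolP //|pq]; exact/eqmodP/asboolP.
Qed.

Lemma limit_repr p : asymptotic (repr (limit_pi p)) p.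
Proof. by apply/limit_piP; rewrite /limit_pi reprK. Qed.

(* Defined through a representative of the class; limit_act_pi, and
   limit_tau_pi below for limit_tau, show that the choice does not matter. *)
Definition limit_act (t : limit_space) (g : G) : limit_space :=
  limit_pi ((repr t).1, ((repr t).2 : G) * g).

Lemma limit_act_pi (w : word_space X) (g h : G) :
  limit_act (limit_pi (w, g)) h = limit_pi (w, g * h).
Proof.
apply/limit_piP; have [K finK [gs gsP]] := limit_repr (w, g).
exists K => //; exists gs => n n0; have [Kn actn secn] := gsP n n0.
by split => //=; rewrite mulgA secn.
Qed.

Definition limit_tau (x : X) (t : limit_space) : limit_space :=
  limit_pi (append (repr t).1 (ss_letter S (repr t).2 x),
            ss_rest S (repr t).2 x).

Lemma limit_tau_pi (x : X) (w : word_space X) (g : G) :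
  limit_tau x (limit_pi (w, g)) =
  limit_pi (append w (ss_letter S g x), ss_rest S g x).
Proof.
apply/limit_piP; have [K finK [gs gsP]] := limit_repr (w, g).
case: (repr (limit_pi (w, g))) gsP => v h /= gsP.
pose e n := if n is 0 then g * h^-1 else gs n.
exists (g * h^-1 |` K); first by rewrite finite_setU; split.
have eP n : [/\ (g * h^-1 |` K) (e n), S (e n) (ending v n) = ending w n &
                ss_section S (e n) (ending v n) * h = g].
  case: n => [|n]; last by have [? ? ?] := gsP n.+1 isT; split => //; right.
  by split; [left|exact: ss_act_nil|exact: mulgVK].
exists (fun n => e n.-1) => -[//|n] _ /=; have [Kn actn secn] := eP n.
split => //; rewrite !ending_append.
- by rewrite ss_act_rcons actn -ss_letterM secn.
- by rewrite ss_section_rcons -ss_restM secn.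
Qed.

End limit_space.

Notation borel T := (@g_sigma_algebraType T open).

Section uniform_bernoulli.
Local Open Scope ring_scope.
Context (R : realType) (X : alphabetType).

(* The sequences ... x_2 x_1 with x_1 x_2 ... x_n = v. *)
Definition cylinder (v : seq X) : set (borel (word_space X)) :=
  [set w | mkseq w (size v) = v].

(* Cylinders, with the empty set, are closed under intersection and generate
   the Borel sigma-algebra, so this determines nu. *)
Definition is_uniform_bernoulli
  (nu : {measure set (borel (word_space X)) -> \bar R}) :=
  forall v : seq X, nu (cylinder v) = ((#|X|%:R ^- size v)%:E)%E.

Lemma cylinderP (v : seq X) :
  cylinder v = \bigcap_(i < size v) [set w | w i = nth point v i].
Proof.
apply/seteqP; split => w /=.
  by move=> <- i /=; rewrite size_mkseq => si; rewrite nth_mkseq.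
move=> wv; apply: (@eq_from_nth _ point); rewrite size_mkseq// => i si.
by rewrite nth_mkseq//; exact: wv.
Qed.

Lemma open_cylinder (U : set (word_space X)) (w : word_space X) :
  open U -> U w -> exists n, cylinder (mkseq w n) `<=` U.
Proof.
move=> oU Uw; apply: contrapT => /forallNP cU.
have {}cU n : exists u : word_space X, cylinder (mkseq w n) u /\ ~ U u.
  by have /existsNP[u /not_implyP] := cU n; exists u.
have [u_ u_P] := choice cU.
have : (u_ @ \oo) --> (w : {ptws nat -> discrete_topology X}).
  apply/pointwise_cvgP => t; apply/discrete_cvg.
  exists t.+1 => // n /= tn.
  have [+ _] := u_P n; rewrite cylinderP => /(_ t); rewrite size_mkseq nth_mkseq//.
  exact.
move=> /(_ U); case; first by apply: open_nbhs_nbhs; split.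
by move=> n _ /(_ n (leqnn n)) /=; have [_] := u_P n.
Qed.

Lemma open_bigcup_cylinder (U : set (word_space X)) : open U ->
  U = \bigcup_(v in [set v | cylinder v `<=` U]) cylinder v.
Proof.
move=> oU; apply/seteqP; split => [w Uw|w [v vU] /vU//].
have [n nU] := open_cylinder oU Uw; exists (mkseq w n) => //.
by rewrite /cylinder/= size_mkseq.
Qed.

Let N : nat := #|X|.

Let N_gt0 : (0 < N)%N.
Proof. by apply/card_gt0P; exists point. Qed.

Let digits (t : R) : word_space X :=
  fun n => nth point (enum X) (Num.truncn (N%:R ^+ n.+1 * t) %% N)%N.

Let measurable_digits :
  measurable_fun setT (digits : measurableTypeR R -> borel (word_space X)).
Proof.
apply: (@measurability _ _ _ _ _ _ (@open (word_space X) : set (set (borel (word_space X))))) => //.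
move=> _ [U oU <-]; rewrite setTI (open_bigcup_cylinder oU) preimage_bigcup.
have mtrunc (c : R) k : measurable [set t : measurableTypeR R | (Num.truncn (c * t) <= k)%N].
  have mf : measurable_fun setT (fun t : measurableTypeR R => c * t).
    exact: mulrl_measurable.
  have := mf measurableT `]-oo, k.+1%:R[%classic (measurable_itv _).
  rewrite setTI; congr (measurable _); apply/seteqP; split => t /=;
    by rewrite in_itv/= -truncn_le_nat.
have mtruncE (c : R) k : measurable [set t : measurableTypeR R | (Num.truncn (c * t) = k)%N].
  case: k => [|k].
    rewrite (_ : mkset _ = [set t | (Num.truncn (c * t) <= 0)%N])//.
    by apply/seteqP; split => t /=; rewrite leqn0 => /eqP.
  rewrite (_ : mkset _ = [set t | (Num.truncn (c * t) <= k.+1)%N] `\`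
                         [set t | (Num.truncn (c * t) <= k)%N]).
    exact: measurableD.
  apply/seteqP; split => t /=; first by move=> ->; rewrite leqnn ltnn.
  by move=> [+ /negP]; rewrite -ltnNge => ? ?; apply/eqP; rewrite eqn_leq; apply/andP.
have mdigit n x : measurable [set t : measurableTypeR R | digits t n = x].
  rewrite (_ : mkset _ = \bigcup_(k in [set k | nth point (enum X) (k %% N)%N = x])
     [set t | (Num.truncn (N%:R ^+ n.+1 * t) = k)%N]).
    by apply: bigcup_measurable.
  apply/seteqP; split => t /=; first by move=> <-; eexists; last reflexivity.
  by move=> [k /= <-] <-.
have mcyl v : measurable (digits @^-1` cylinder v : set (measurableTypeR R)).
  rewrite cylinderP preimage_bigcap; apply: bigcap_measurableType => i _.
  exact: mdigit.
rewrite bigcup_mkcond; apply: countable_bigcupT_measurable; first exact: countableP.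
by move=> v; case: ifP.
Qed.

Let code (v : seq X) : nat := foldl (fun k x => k * N + index x (enum X))%N 0%N v.

Let code_rcons v x : code (rcons v x) = (code v * N + index x (enum X))%N.
Proof. by rewrite /code foldl_rcons. Qed.

Let index_lt x : (index x (enum X) < N)%N.
Proof. by rewrite /N cardE index_mem mem_enum. Qed.

Let code_lt v : (code v < N ^ size v)%N.
Proof.
elim/last_ind: v => [//|v x IH]; rewrite code_rcons size_rcons expnSr.
rewrite (@leq_trans ((code v).+1 * N))//; last by rewrite leq_mul2r IH orbT.
by rewrite mulSn addnC ltn_add2r.
Qed.

Let truncn_divn (t : R) m : 0 <= t ->
  (Num.truncn (N%:R ^+ m.+1 * t) %/ N)%N = Num.truncn (N%:R ^+ m * t).
Proof.
move=> t0; have N0 : 0 < N%:R :> R by rewrite ltr0n.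
have Nt k : 0 <= N%:R ^+ k * t by rewrite mulr_ge0// exprn_ge0// ltW.
set b := Num.truncn _; apply/esym/truncn_def.
have /andP[b1 b2] := truncn_itv (Nt m.+1); rewrite -/b in b1 b2.
apply/andP; split.
  rewrite -(ler_pM2l N0) mulrA -exprS (le_trans _ b1)//.
  by rewrite -natrM ler_nat mulnC leq_divM.
rewrite -(ltr_pM2l N0) mulrA -exprS (lt_le_trans b2)//.
by rewrite -natrM ler_nat mulnC ltn_ceil.
Qed.

Let digits_code (t : R) (v : seq X) : 0 <= t < 1 ->
  mkseq (digits t) (size v) = v <-> Num.truncn (N%:R ^+ size v * t) = code v.
Proof.
move=> /andP[t0 t1]; elim/last_ind: v => [|v x IH].
  by split=> // _; apply: truncn_def; rewrite expr0 mul1r t0.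
rewrite size_rcons mkseqS code_rcons.
rewrite (divn_eq (Num.truncn (N%:R ^+ (size v).+1 * t)) N) truncn_divn//.
have mN k : (k %% N < N)%N by rewrite ltn_mod.
split => [/rcons_inj[/IH -> <-]|E].
  by rewrite /digits index_uniq ?enum_uniq// -cardE.
have E1 : Num.truncn (N%:R ^+ size v * t) = code v.
  by have /(congr1 (divn^~ N)) := E; rewrite !divnMDl// !divn_small// !addn0.
have E2 : (Num.truncn (N%:R ^+ (size v).+1 * t) %% N)%N = index x (enum X).
  by move/eqP: E; rewrite E1 eqn_add2l => /eqP.
have /IH -> := E1; congr rcons.
by rewrite /digits E2 nth_index// mem_enum.
Qed.

(* The image of Lebesgue measure on [0, 1) under base-#|X| expansion. *)
Lemma uniform_bernoulli_exists : exists nu, is_uniform_bernoulli nu.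
Proof.
have m01 : measurable (`[0, 1[%classic : set (measurableTypeR R)).
  exact: measurable_itv.
pose mu : {measure set (measurableTypeR R) -> \bar R} :=
  mrestr lebesgue_measure m01.
have [nu nuE] : exists nu : {measure set (borel (word_space X)) -> \bar R},
    forall A, nu A = mu (digits @^-1` A).
  unshelve (exists (pushforward mu
    (digits : measurableTypeR R -> borel (word_space X)))) => //.
exists nu => v; rewrite nuE /mu/= /mrestr.
have N0 : 0 < N%:R ^+ size v :> R by rewrite exprn_gt0// ltr0n.
have -> : digits @^-1` cylinder v `&` `[0, 1[ =
    `[(code v)%:R / N%:R ^+ size v, (code v).+1%:R / N%:R ^+ size v[%classic.
  apply/seteqP; split => t /=; rewrite !in_itv/=.
    move=> [tv t01]; have := (digits_code v t01).1 tv.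
    move: t01 => /andP[t0 t1] E.
    have /andP[] := truncn_itv (mulr_ge0 (ltW N0) t0).
    by rewrite E ler_pdivrMr// ltr_pdivlMr// mulrC => -> ->.
  rewrite ler_pdivrMr// ltr_pdivlMr// => /andP[t1 t2].
  have t01 : 0 <= t < 1.
    apply/andP; split; first by rewrite -(pmulr_lge0 _ N0) (le_trans _ t1).
    rewrite -(ltr_pM2r N0) mul1r (lt_le_trans t2)// -natrX ler_nat.
    exact: code_lt.
  split => //; apply/digits_code => //; apply: truncn_def.
  by rewrite mulrC t1.
rewrite lebesgue_measure_itv/= lte_fin ltr_pM2r ?invr_gt0// ltr_nat ltnSn.
by rewrite -EFinD -mulrBl -natrB// subSnn mul1r.
Qed.

Definition uniform_bernoulli : {measure set (borel (word_space X)) -> \bar R} :=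
  projT1 (cid uniform_bernoulli_exists).

Lemma uniform_bernoulliP : is_uniform_bernoulli uniform_bernoulli.
Proof. exact: projT2 (cid uniform_bernoulli_exists). Qed.

End uniform_bernoulli.

Section limit_measure.
Local Open Scope ereal_scope.
Context (R : realType) (G : groupType) (X : alphabetType).
Variable S : self_similar_action G X.

(* m1 \x^ m2 is the product measure computed as the m2-integral of the
   m1-measure of sections; only m1 needs to be sigma-finite. *)
Definition marked_words_measure :=
  uniform_bernoulli R X \x^ (@counting (discrete_group G) R).

Definition limit_measure : set (borel (limit_space S)) -> \bar R :=
  pushforward marked_words_measure (limit_pi S : _ -> borel (limit_space S)).

End limit_measure.

Arguments limit_measure R {G X} S A.

Definition homeomorphism (A B : topologicalType) (f : A -> B) :=
  continuous f /\
  exists g : B -> A, [/\ continuous g, cancel f g & cancel g f].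

(* Main.v *)
Require Import Defs.
From HB Require Import structures.
From mathcomp Require Import all_boot all_order all_algebra.
From mathcomp Require finmap.
From mathcomp Require Import all_classical all_reals all_analysis.

(* Write B_n(U) for the set of pairs (w, h) such that the whole n-th level
   piece tau_u(K) . h of X_(G,Y) around (w, h), with u the ending of w of length
   n, lies in an open set U; here K is the union of the translates of the tile
   by a finite section-closed set containing labels for alpha of the tile.  By
   contraction and compactness the pieces shrink to points, so B_n(U) increases
   to the preimage of U.  The cocycle identity for alpha and tau makes alpha map
   the n-th level piece of v in X_(G,X) into the piece of a word u(v) in
   X_(G,Y), up to right translation, and v |-> u(v) is a bijection of words of
   length n.
   Hence mu_Y(B_n(U)) <= mu_X(alpha^-1 U), and mu_Y(U) <= mu_X(alpha^-1 U) in
   the limit.  The inverse of alpha satisfies the same hypotheses, so equality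
   holds on open sets, and then on Borel sets because countably many open sets
   of finite measure cover the limit space. *)

Set Implicit Arguments.
Unset Strict Implicit.
Unset Printing Implicit Defensive.

Import Order.TTheory GRing.Theory Num.Theory.

Local Open Scope classical_set_scope.
Local Open Scope group_scope.

(** * Finite endings of left-infinite words *)

Lemma ending_S (X : Type) (w : word_space X) n :
  ending w n.+1 = w n :: ending w n.
Proof. by rewrite /ending mkseqS rev_rcons. Qed.

Lemma size_ending (X : Type) (w : word_space X) n : size (ending w n) = n.
Proof. by rewrite size_rev size_mkseq. Qed.

Lemma ending_add (X : Type) (w : word_space X) m n :
  ending w (m + n) = ending (fun i => w (n + i)%N) m ++ ending w n.
Proof. by elim: m => [//|m IH]; rewrite addSn !ending_S IH addnC. Qed.

Lemma finite_short_words (X : finType) n :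
  finite_set [set v : seq X | (size v < n)%N].
Proof.
pose word (i : {m : 'I_n & m.-tuple X}) : seq X := tagged i.
apply: (@sub_finite_set _ _ (range word)).
  move=> v /= vn; pose t : (Ordinal vn).-tuple X := in_tuple v.
  by exists (Tagged (fun m : 'I_n => m.-tuple X) t).
exact/finite_image/finite_finset.
Qed.

(** * Topology of the space of left-infinite words *)

Section near_words.
Context (X : alphabetType).

Lemma near_ending (w : word_space X) n :
  \forall w' \near w, ending w' n = ending w n.
Proof.
elim: n => [|n IH]; first by near=> w'.
have /= Hn : \forall w' \near w, w' n = w n.
  apply: (@proj_continuous nat (fun=> discrete_topology X) n w [set w n]).
  exact: discrete_set1.
by near=> w'; rewrite !ending_S; congr (_ :: _); near: w'.
Unshelve. all: by end_near. Qed.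

Lemma word_space_compact : compact [set: word_space X].
Proof.
have cX : compact [set: discrete_topology X].
  exact/finite_compact/(@finite_finset X setT).
have := @tychonoff nat (fun=> discrete_topology X) (fun=> setT) (fun=> cX).
by congr compact; apply/seteqP; split.
Qed.

End near_words.

(** * Contraction and asymptotic equivalence at finite levels *)

Section self_similar.
Context (G : groupType) (X : alphabetType) (S : self_similar_action G X).
Implicit Types (g h k : G) (v w : seq X) (K : set G) (p q : marked_words G X).

Definition section_closed K := forall g x, K g -> K (ss_rest S g x).

Lemma section_closed_section K g v :
  section_closed K -> K g -> K (ss_section S g v).
Proof. by move=> cK; elim: v g => [//|x v IH] g Kg; apply: IH; exact: cK. Qed.

Lemma ss_section_cat g v w :
  ss_section S g (v ++ w) = ss_section S (ss_section S g v) w.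
Proof. exact: foldl_cat. Qed.

Lemma size_ss_act g v : size (S g v) = size v.
Proof. by elim: v g => [|x v IH] g; rewrite ?ss_act_nil// ss_actE /= IH. Qed.

Hypothesis cS : contracting S.

(** The hull consists of all sections of elements of [K]. For each [g] in [K], sections along long
    words fall into the finite set [N], and there are finitely many short words. *)
Lemma finite_section_closed_hull K : finite_set K ->
  exists K', [/\ finite_set K', section_closed K' & K `<=` K'].
Proof.
move=> finK; have [N finN NP] := cS.
exists [set ss_section S g v | g in K & v in setT]; split.
- rewrite (_ : image2 _ _ _ = \bigcup_(g in K) range (ss_section S g)).
    apply: bigcup_finite => // g _; have [n gn] := NP g.
    pose short := [set v : seq X | (size v < n)%N].
    apply: (@sub_finite_set _ _ (N `|` ss_section S g @` short)).
      move=> _ [v _ <-]; have [vn|nv] := ltnP (size v) n.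
        by right; exists v.
      by left; exact: gn.
    by rewrite finite_setU; split => //; exact/finite_image/finite_short_words.
  apply/seteqP; split.
    by move=> _ [g Kg [v _ <-]]; exists g => //; exists v.
  by move=> _ [g Kg [v _ <-]]; exists g => //; exists v.
- move=> _ x [g Kg [v _ <-]]; exists g => //; exists (rcons v x) => //.
  by rewrite ss_section_rcons.
- by move=> g Kg; exists g => //; exists [::].
Qed.

(* Asymptotic equivalence up to level n. *)
Definition tail_related K n p q := exists2 k, K k &
  S k (ending p.1 n) = ending q.1 n /\
  ss_section S k (ending p.1 n) * (p.2 : G) = q.2.

(** If [k] relates [p] and [q] at level [n], its section along the [n - m] letters farthest to the
    left relates them at level [m]. *)
Lemma tail_related_leq K m n p q : section_closed K -> (m <= n)%N ->
  tail_related K n p q -> tail_related K m p q.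
Proof.
move=> cK mn [k Kk]; rewrite -(subnK mn) !ending_add ss_act_cat ss_section_cat.
set v := ending _ (n - m) => -[/eqP + sec].
rewrite eqseq_cat ?size_ss_act ?size_ending// => /andP[_ /eqP act].
by exists (ss_section S k v) => //; exact: section_closed_section.
Qed.

(** One finite set serves all pairs and levels: take a connecting element from a level so much
    higher that its section, still connecting at level [n], has entered the nucleus. *)
Lemma asymptotic_tail_related : exists N : set G,
  [/\ finite_set N, section_closed N &
   forall p q n, asymptotic S p q -> tail_related N n p q].
Proof.
have [N0 finN0 N0P] := cS.
have [N [finN cN N0N]] := finite_section_closed_hull finN0.
exists N; split => // p q n [K finK [gs gsP]].
have [m mP] : exists m, forall g v, K g -> (m <= size v)%N ->
    N0 (ss_section S g v).
  have [f fP] := choice N0P.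
  have /finite_seqP[s sE] := finK.
  exists (\max_(g <- s) f g) => g v; rewrite sE => gs' mv; apply: fP.
  by apply: leq_trans mv; exact: (leq_bigmax_seq g gs').
(* The successor keeps the level positive, as [gsP] requires, even for [m = n = 0]. *)
have [Kn act sec] := gsP (m + n).+1%N isT.
move: act sec; rewrite -addSn !ending_add ss_act_cat ss_section_cat.
set v := ending _ m.+1 => /eqP + sec.
rewrite eqseq_cat ?size_ss_act ?size_ending// => /andP[_ /eqP act].
exists (ss_section S (gs (m + n).+1) v); last by rewrite -addSn.
by apply: N0N; apply: mP => //; rewrite size_ending.
Qed.

Lemma tail_related_asymptotic K p q : finite_set K ->
  (forall n, tail_related K n p q) -> asymptotic S p q.
Proof.
move=> finK Kpq; exists K => //.
have /choice[gs gsP] : forall n, exists k, [/\ K k,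
    S k (ending p.1 n) = ending q.1 n &
    ss_section S k (ending p.1 n) * (p.2 : G) = q.2].
  by move=> n; have [k Kk []] := Kpq n; exists k.
by exists gs => n _; exact: gsP.
Qed.

Lemma near_marked p n :
  \forall q \near p, ending q.1 n = ending p.1 n /\ q.2 = p.2.
Proof.
exists ([set w | ending w n = ending p.1 n], [set p.2]); last by move=> q [].
by split; [exact: near_ending|exact: (@discrete_set1 (discrete_topology G))].
Qed.

Lemma tail_related_local K n p p' q q' :
    ending p.1 n = ending p'.1 n -> p.2 = p'.2 ->
    ending q.1 n = ending q'.1 n -> q.2 = q'.2 ->
  tail_related K n p q -> tail_related K n p' q'.
Proof. by rewrite /tail_related => -> -> -> ->. Qed.

(** This is the shrinking of pieces to points. All points related to [p] lie in a compact set [D],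
    and a point outside [O] ceases to be related to [p] from some level on, together with a
    neighbourhood; finitely many such levels suffice. *)
Lemma tail_related_sub_open K p (O : set (marked_words G X)) :
    finite_set K -> section_closed K -> open O ->
    (forall q, asymptotic S p q -> O q) ->
  exists n, forall q, tail_related K n p q -> O q.
Proof.
move=> finK cK oO pO.
pose D : set (marked_words G X) := setT `*` [set k * (p.2 : G) | k in K].
have cD : compact D.
  apply: compact_setX; first exact: word_space_compact.
  exact/finite_compact/finite_image.
have /compact_near_coveringP := cD.
case/(_ nat \oo (fun n q => tail_related K n p q -> O q)).
- move=> q _; have [Oq|/(contra_not (pO q))] := pselect (O q).
    exists (O, setT) => [|[q' n] [/= ? _]//].
    by split; [exact: open_nbhs_nbhs|exact: filterT].
  (* Failure at level [m] persists at higher levels and depends only on [m] letters and the label of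
     [q]. *)
  move=> /(contra_not (tail_related_asymptotic finK)) /existsNP[m nm].
  exists ([set q' | ending q'.1 m = ending q.1 m /\ q'.2 = q.2],
          [set n | (m <= n)%N]).
    by split; [exact: near_marked|exists m].
  move=> [q' n] [/= [e1 e2] mn] /(tail_related_leq cK mn) a; exfalso; apply: nm.
  exact: tail_related_local a.
- move=> n _ /(_ n (leqnn n)) nP; exists n => q nq; apply: nP => //.
  split => //=; have [k Kk [_ <-]] := nq.
  exists (ss_section S k (ending p.1 n)) => //.
  exact: section_closed_section.
Qed.

End self_similar.

(** * Countability of contracting groups and finite exhaustions *)

Section countability.
Context (G : groupType) (X : alphabetType) (S : self_similar_action G X).

Lemma ss_act_section_inj n (g h : G) :
    (forall v : seq X, size v = n -> S g v = S h v) ->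
    (forall v : seq X, size v = n -> ss_section S g v = ss_section S h v) ->
  g = h.
Proof.
move=> act sec; apply: (@ss_faithful _ _ S) => w.
have long (u : seq X) : (n <= size u)%N -> S g u = S h u.
  move=> nu; rewrite -(cat_take_drop n u) !ss_act_cat act ?sec//;
  by rewrite size_takel.
(* Padding makes the word long enough for [long]; the action preserves prefixes, so the padding can
   be cut off again. *)
have := long (w ++ nseq n point).
rewrite size_cat size_nseq leq_addl => /(_ isT); rewrite !ss_act_cat.
by move=> /(congr1 (take (size w))); rewrite !take_size_cat ?size_ss_act.
Qed.

(* An element is determined by a level at which its sections lie in the
   nucleus, together with its action and its sections on that level. *)
Lemma contracting_countable : contracting S -> countable [set: G].
Proof.
move=> [N /finite_seqP[s ->] NP]; have [k kP] := choice NP.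
(* Sections are recorded by their index in [s], so that codes have a countable type; [k g] ensures
   that equal codes refer to the same level. *)
pose code g := (k g,
  [seq (S g (v : seq X), index (ss_section S g v) s) | v : (k g).-tuple X]).
apply/countable_injP; exists (pickle \o code) => g h _ _ /(pcan_inj pickleK).
move=> /pair_equal_spec[kgh]; rewrite -kgh => /eq_in_map gh.
have {}gh (v : seq X) : size v = k g -> S g v = S h v /\
    index (ss_section S g v) s = index (ss_section S h v) s.
  move=> /eqP vk; have := gh (Tuple vk); rewrite mem_enum => /(_ isT) /=.
  by move=> [-> ->].
apply: (@ss_act_section_inj (k g)) => v vk; first by have [] := gh v vk.
have gs : ss_section S g v \in s by apply: kP; rewrite vk.
have hs : ss_section S h v \in s by apply: kP; rewrite vk kgh.
by rewrite -(nth_index 1 gs) -(nth_index 1 hs); have [_ ->] := gh v vk.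
Qed.

End countability.

Lemma finite_exhaustion (T : pointedType) : countable [set: T] ->
  exists J : nat -> set T, [/\ forall n, finite_set (J n),
    forall m n, (m <= n)%N -> J m `<=` J n & forall t, exists n, J n t].
Proof.
move=> /countable_injP[f finj].
have /choice[e eP] : forall n, exists t, forall u, f u = n -> u = t.
  move=> n; have [[t tn]|nex] := pselect (exists t, f t = n).
    by exists t => u un; apply: finj; rewrite ?inE// un.
  by exists point => u un; exfalso; apply: nex; exists u.
exists (fun n => e @` `I_n); split.
- by move=> n; exact: finite_image.
- by move=> m n mn _ [i /= im <-]; exists i => //=; exact: leq_trans mn.
- by move=> t; exists (f t).+1, (f t) => //=; exact/esym/eP.
Qed.

(** * The measure of marked words and its cells *)

Section marked_measure.
Local Open Scope ring_scope.
Local Open Scope ereal_scope.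
Context (R : realType) (X : alphabetType).

(* An alias, as a further structure cannot be attached to the already packaged
   measure uniform_bernoulli. *)
Definition word_measure : set (borel (word_space X)) -> \bar R :=
  uniform_bernoulli R X.

HB.instance Definition _ := Measure.copy word_measure (uniform_bernoulli R X).

Lemma word_measure_setT : word_measure setT = 1.
Proof.
have := @uniform_bernoulliP R X [::]; rewrite expr0 invr1 => <-; congr (_ _).
by apply/seteqP; split.
Qed.

HB.instance Definition _ := Measure_isProbability.Build _ _ _
  word_measure word_measure_setT.

Context (G : groupType).

Definition marked_measurable : measurableType _ :=
  (borel (word_space X) * discrete_group G)%type.

Definition marked_measure : {measure set marked_measurable -> \bar R} :=
  word_measure \x^ @counting (discrete_group G) R.

Definition cell (i : seq X * G) : set marked_measurable :=
  cylinder i.1 `*` [set i.2].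

Lemma open_cylinder_set (v : seq X) : open (cylinder v : set (word_space X)).
Proof.
rewrite openE => w wv; near=> w'; rewrite /cylinder/=.
suff : ending w' (size v) = ending w (size v).
  by move=> /(can_inj revK) ->.
by near: w'; exact: near_ending.
Unshelve. all: by end_near. Qed.

Lemma measurable_cell i : measurable (cell i).
Proof.
apply: measurableX => //; apply: sub_sigma_algebra; exact: open_cylinder_set.
Qed.

Lemma marked_measure_cell i :
  marked_measure (cell i) = ((#|X|%:R ^- size i.1)%:E)%R.
Proof.
rewrite /marked_measure/= product_measure2E//; last first.
  by apply: sub_sigma_algebra; exact: open_cylinder_set.
rewrite uniform_bernoulliP /= /counting asboolT; last exact: finite_set1.
by rewrite fset_set1 finmap.cardfs1 mule1.
Qed.

Lemma trivIset_cell n (I : set (seq X * G)) :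
  (forall i, I i -> size i.1 = n) -> trivIset I cell.
Proof.
move=> In [v g] [v' g'] /In/= vn /In/= v'n [[w h]] [] [/= wv ->] [/= wv' ->].
by move: wv wv'; rewrite /cylinder/= vn v'n => <- <-.
Qed.

Lemma marked_measure_cells n (I : set (seq X * G)) : finite_set I ->
    (forall i, I i -> size i.1 = n) ->
  marked_measure (\bigcup_(i in I) cell i) =
  \sum_(i \in I) (#|X|%:R ^- n : R)%R%:E.
Proof.
move=> finI In; rewrite measure_fin_bigcup//.
- apply: eq_fsbigr => i; rewrite inE => /In <-; exact: marked_measure_cell.
- exact: trivIset_cell In.
- by move=> i _; exact: measurable_cell.
Qed.

Lemma marked_continuous (g : G) :
  continuous (fun w : word_space X => (w, g) : marked_words G X).
Proof.
move=> w A [[B C] [/= wB gC] BC]; apply: filterS wB => w' Bw'; apply: BC.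
by split => //=; exact: (@nbhs_singleton (discrete_group G) g).
Qed.

(** Countability of [G] is what places open sets in the product sigma-algebra: an open set is the
    union of its slices over the elements of [G]. *)
Lemma open_marked_measurable (O : set (marked_words G X)) :
  countable [set: G] -> open O -> measurable (O : set marked_measurable).
Proof.
move=> cG oO.
rewrite (_ : O = \bigcup_(g : G) ([set w | O (w, g)] `*` [set g])); last first.
  by apply/seteqP; split => [[w g] Owg|[w g] [_ _ [/= + ->]]//]; exists g.
apply: countable_bigcupT_measurable => // g; apply: measurableX => //.
apply: sub_sigma_algebra.
by apply: (open_comp _ oO) => w _; exact: marked_continuous.
Qed.

End marked_measure.

(** * Topology and finite-measure exhaustion of the limit space *)

Section limit_space_topology.
Context (G : groupType) (X : alphabetType) (S : self_similar_action G X).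
Hypothesis cS : contracting S.

(** Constraining every representative, not just one, makes this set open and puts its preimage
    inside [setT] times [F]. *)
Definition labelled (F : set G) : set (limit_space S) :=
  [set t | forall w g, limit_pi S (w, g) = t -> F g].

Lemma limit_pi_surj (t : limit_space S) : exists w g, t = limit_pi S (w, g).
Proof.
by exists (repr t).1, (repr t).2; rewrite -surjective_pairing /limit_pi reprK.
Qed.

Lemma limit_pi_continuous : continuous (limit_pi S).
Proof. exact: pi_continuous. Qed.

(** By [tail_related_sub_open], some level [n] already forces labels into [F], and relations at
    level [n] are unchanged for marked words near [p]. *)
Lemma open_labelled F : open (labelled F).
Proof.
have [N [finN cN NP]] := asymptotic_tail_related cS.
rewrite /open /= /quotient_open openE => p Fp.
have [|q pq|n nP] := @tail_related_sub_open _ _ S N p [set q | F q.2] finN cN.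
- rewrite openE => q Fq; apply: filterS (near_marked q 0) => q' [_ /= ->].
  exact: Fq.
- apply: (Fp q.1); rewrite -surjective_pairing.
  exact/limit_piP/asymptotic_imp.
apply: filterS (near_marked p n) => p' [e1 e2] w g /limit_piP.
move=> /asymptotic_imp/(NP _ _ n) a; apply: (nP (w, g)).
exact: tail_related_local a.
Qed.

(** The labels of a point represented by [(w, g)] lie in the finite set of products of elements of
    [N] with [g]. *)
Lemma labelled_exhaustion : exists F : nat -> set G, [/\
  forall n, finite_set (F n), forall m n, (m <= n)%N -> F m `<=` F n &
  forall t, exists n, labelled (F n) t].
Proof.
have [N [finN cN NP]] := asymptotic_tail_related cS.
have [J [finJ ndJ JT]] :=
  @finite_exhaustion (discrete_group G) (contracting_countable cS).
exists (fun n => [set k * g | k in N & g in (J n : set G)]); split.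
- by move=> n; exact: finite_image2.
- move=> m n mn _ [k Nk [g Jg <-]].
  by exists k => //; exists g => //; exact: ndJ Jg.
- move=> t; have [w [g ->]] := limit_pi_surj t; have [n Jg] := JT g.
  exists n => w' g'.
  move=> /limit_piP/asymptotic_imp/(NP _ _ 0)[k Nk [_ /= <-]].
  by exists k => //; exists g.
Qed.

Lemma labelled_sub (F F' : set G) : F `<=` F' -> labelled F `<=` labelled F'.
Proof. by move=> FF' t Ft w g /Ft/FF'. Qed.

Lemma continuous_labelled (Y : alphabetType)
    (f : word_space Y -> limit_space S) :
  continuous f -> exists2 F, finite_set F & forall w, labelled F (f w).
Proof.
move=> cf; have [F [finF ndF FT]] := labelled_exhaustion.
have /compact_near_coveringP/(_ nat \oo (fun n w => labelled (F n) (f w))) :=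
  @word_space_compact Y.
case=> [w _|n _ /(_ n (leqnn n)) nP]; last by exists (F n) => // w; exact: nP.
have [n nw] := FT (f w).
exists (f @^-1` labelled (F n), [set m | (n <= m)%N]).
  split; last by exists n.
  by apply: cf; apply: open_nbhs_nbhs; split => //; exact: open_labelled.
by move=> [w' m] [/= + nm]; apply: labelled_sub; exact: ndF.
Qed.

Local Open Scope ring_scope.
Local Open Scope ereal_scope.
Context (R : realType).

Lemma measurable_limit_pi :
  measurable_fun setT
    (limit_pi S : marked_measurable X G -> borel (limit_space S)).
Proof.
apply: (@measurability _ _ _ _ _ _
  (@open (limit_space S) : set (set (borel (limit_space S))))) => //.
move=> _ [U oU <-]; rewrite setTI.
by apply: open_marked_measurable => //; exact: (contracting_countable cS).
Qed.

Lemma limit_measureE A :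
  limit_measure R S A = marked_measure R X G (limit_pi S @^-1` A).
Proof. by []. Qed.

Lemma limit_measure_labelled F : finite_set F ->
  limit_measure R S (labelled F) < +oo.
Proof.
move=> finF; rewrite limit_measureE.
apply: (@le_lt_trans _ _ (marked_measure R X G (setT `*` F))).
  apply: le_measure; rewrite ?inE.
  - apply: open_marked_measurable; first exact: (contracting_countable cS).
    exact: open_labelled.
  - exact: measurableX.
  - by move=> [w g] /= /(_ w g erefl).
have -> : marked_measure R X G (setT `*` F) =
    word_measure R [set: borel (word_space X)] *
    @counting (discrete_group G) R F.
  exact: product_measure2E.
by rewrite word_measure_setT mul1e /= /counting asboolT// ltry.
Qed.

End limit_space_topology.

(** * The map of finite words induced by [alpha] *)

Lemma ss_letter1 (G : groupType) (X : Type) (S : self_similar_action G X) x :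
  ss_letter S 1 x = x.
Proof. by have := ss_act1 S [:: x]; rewrite ss_actE => -[]. Qed.

Lemma ss_letter_inj (G : groupType) (X : Type) (S : self_similar_action G X) g :
  injective (ss_letter S g).
Proof.
move=> x y xy; rewrite -(ss_letter1 S x) -(ss_letter1 S y).
by rewrite -(mulVg g) !ss_letterM xy.
Qed.

Section transducer.
Context (G : groupType) (X Y : alphabetType).
Context (SX : self_similar_action G X) (SY : self_similar_action G Y).
Context (alpha : limit_space SX -> limit_space SY).
Context (letter : X -> Y) (shift : X -> G).
Hypothesis alpha_equivariant : forall t g,
  alpha (limit_act t g) = limit_act (alpha t) g.
Hypothesis alpha_tau : forall t x,
  alpha (limit_tau x t) = limit_act (limit_tau (letter x) (alpha t)) (shift x).

(* As in [cylinder], the list v lists the word x_n ... x_1 from x_1 on.  With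
   (u, s) = transduce v, alpha (tau_v t) = tau_u (alpha t) . s. *)
Fixpoint transduce (v : seq X) : seq Y * G :=
  if v is x :: v' then
    let us := transduce v' in
    (ss_letter SY us.2 (letter x) :: us.1, ss_rest SY us.2 (letter x) * shift x)
  else ([::], 1).

Lemma size_transduce v : size (transduce v).1 = size v.
Proof. by elim: v => [//|x v /= ->]. Qed.

Hypothesis letter_inj : injective letter.

(** The tail of the output determines the tail of the input by induction, hence the group element
    acting on the head, which can then be undone. *)
Lemma transduce_inj : injective (fun v => (transduce v).1).
Proof.
elim=> [|x v IH] [|y w] //= [+ /IH vw]; rewrite -vw.
by move=> /(@ss_letter_inj _ _ SY) e; rewrite (letter_inj e).
Qed.

Lemma transduce_surj (u : seq Y) : #|X| = #|Y| ->
  exists2 v, size v = size u & (transduce v).1 = u.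
Proof.
move=> cXY; pose n := size u.
have sz (v : n.-tuple X) : size (transduce v).1 == n.
  by rewrite size_transduce size_tuple.
pose f v := Tuple (sz v).
have f_inj : injective f.
  by move=> v w /(congr1 val) /transduce_inj; exact: val_inj.
have := inj_card_onto f_inj.
rewrite !card_tuple cXY leqnn => /(_ isT (in_tuple u)) /codomP[v vu].
exists v; first by rewrite size_tuple.
by have /(congr1 val) /= <- := vu.
Qed.

(** The point of [w] arises from that of its shift by applying [tau] for the last [n] letters, and
    [alpha_tau] applies to each. A label [f] of the image of the shifted point acts on the output
    word, so the image lies in the piece of that word up to [f]. *)
Lemma alpha_transduce (w : word_space X) n (z : word_space Y) (f : G) :
    let us := transduce (mkseq w n) in
    alpha (limit_pi SX ((fun i => w (n + i)%N), 1)) = limit_pi SY (z, f) ->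
  exists2 z' : word_space Y, ending z' n = SY f (rev us.1) &
    alpha (limit_pi SX (w, 1)) =
    limit_pi SY (z', ss_section SY f (rev us.1) * us.2).
Proof.
elim: n w => [|n IH] w us zf; rewrite {}/us.
  by exists z; rewrite ?ss_act_nil//= mulg1.
pose w' : word_space X := fun i => w i.+1.
have mkseqE : mkseq w n.+1 = w 0 :: mkseq w' n.
  by rewrite /mkseq /= -[1%N]/(1 + 0)%N iotaDl -map_comp.
have wE : limit_pi SX (w, 1) = limit_tau (w 0) (limit_pi SX (w', 1)).
  rewrite limit_tau_pi ss_rest1; congr (limit_pi _ (_, _)).
  by apply/funext => -[|i] //=; rewrite ss_letter1.
have [z' z'f aw'] := IH w' zf; rewrite mkseqE wE alpha_tau aw' /=.
set us := transduce _ in z'f aw' *; set y := letter _.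
rewrite limit_tau_pi limit_act_pi rev_cons ss_act_rcons ss_section_rcons.
eexists; last by rewrite ss_restM -mulgA.
by rewrite ending_append z'f ss_letterM.
Qed.

Local Open Scope ring_scope.
Local Open Scope ereal_scope.
Context (R : realType).
Hypotheses (cSX : contracting SX) (cSY : contracting SY).
Hypotheses (alpha_cont : continuous alpha) (cardXY : #|X| = #|Y|).

Lemma le_limit_measure_open (U : set (limit_space SY)) : open U ->
  limit_measure R SY U <= limit_measure R SX (alpha @^-1` U).
Proof.
move=> oU.
have cGX := contracting_countable cSX.
have [F finF tileF] : exists2 F, finite_set F &
    forall w, labelled F (alpha (limit_pi SX (w, 1%g))).
  apply: (continuous_labelled cSY (f := fun w => alpha (limit_pi SX (w, 1%g)))).
  move=> w; apply: continuous_comp; last exact: alpha_cont.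
  apply: (@continuous_comp _ _ _ (fun w => (w, 1%g) : marked_words G X)).
    exact: marked_continuous.
  exact: limit_pi_continuous.
(* The identity in [K] gives [B n] inside the preimage of [U], [F] supplies the labels of [alpha] on
   the tile, and closure under sections makes [B] increasing. *)
have [K [finK cK FK]] : exists K, [/\ finite_set K, section_closed SY K &
    (1%g |` F) `<=` K].
  by apply: finite_section_closed_hull => //; rewrite finite_setU; split.
(* Restricting labels to [J n] makes [B n] a finite union of cells. *)
have [J [finJ ndJ JT]] := @finite_exhaustion (discrete_group G) cGX.
pose inside n w (h : G) :=
  forall q, tail_related SY K n (w, h) q -> U (limit_pi SY q).
pose I n := [set i : seq Y * G | [/\ size i.1 = n, J n i.2 &
  forall w, cylinder i.1 w -> inside n w i.2]].
pose B n := \bigcup_(i in I n) cell i.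
have BE n w h : B n (w, h) <-> J n h /\ inside n w h.
  split=> [[i [iz iJ iin] [/= cw hi]]|[Jh inw]].
    by split; rewrite hi//; exact: iin.
  exists (mkseq w n, h); last by split; rewrite /cylinder//= size_mkseq.
  split; rewrite /= ?size_mkseq// => w' cw' q q'; apply: inw.
  apply: tail_related_local q' => //=; rewrite /ending; congr rev.
  by move: cw'; rewrite /cylinder /= size_mkseq.
have finI n : finite_set (I n).
  apply: (@sub_finite_set _ _ ([set v : seq Y | (size v < n.+1)%N] `*` J n)).
    by move=> [u h] [/= -> Jh _]; split.
  by apply: finite_setX; [exact: finite_short_words|].
have szI n i : I n i -> size i.1 = n by case.
have mB n : measurable (B n).
  by apply: fin_bigcup_measurable => // i _; exact: measurable_cell.
have ndB : nondecreasing_seq B.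
  move=> m n mn; apply/subsetPset => -[w h] /BE[Jh inw]; apply/BE; split.
    exact: ndJ Jh.
  by move=> q /(tail_related_leq cK mn); exact: inw.
have UB : limit_pi SY @^-1` U = \bigcup_n B n.
  apply/seteqP; split=> -[w h]; last first.
    move=> [n _ /BE[_]]; apply; exists 1%g; first by apply: FK; left.
    by rewrite ss_act1 ss_section1 mul1g.
  move=> Uwh; have [m Jm] := JT h.
  (* One level brings the piece into [U], another brings [h] into [J]; their maximum does both. *)
  have [||n nP] := @tail_related_sub_open _ _ SY K (w, h)
    (limit_pi SY @^-1` U) finK cK.
  - by apply: open_comp => // ? _; exact: limit_pi_continuous.
  - by move=> q /limit_piP /= <-.
  exists (maxn m n) => //; apply/BE; split.
    exact: ndJ (leq_maxl _ _) _ Jm.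
  by move=> q /(tail_related_leq cK (leq_maxr m n)); exact: nP.
have /choice[inv invP] : forall u, exists v,
    size v = size u /\ (transduce v).1 = u.
  by move=> u; have [v vu uE] := transduce_surj u cardXY; exists v.
(* The inverse in the label cancels the translation that [alpha] introduces on the piece of
   [inv i.1]. *)
pose psi (i : seq Y * G) : seq X * G :=
  (inv i.1, (transduce (inv i.1)).2^-1 * i.2)%g.
have psi_inj : injective psi.
  move=> [u h] [u' h'] /= [uu']; have [_ ue] := invP u; have [_ ue'] := invP u'.
  by move: ue; rewrite uu' ue' => <- /mulgI ->.
have psiI n : \bigcup_(i in psi @` I n) cell i `<=`
    limit_pi SX @^-1` (alpha @^-1` U).
  move=> [w g] [_ [[u h] [/= un _ inu] <-] [/= wv ->]] /=.
  have [vu ue] := invP u.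
  set v := inv u in vu ue wv *; set s := (transduce v).2.
  have mkv : mkseq w n = v by rewrite -un -vu.
  have -> : limit_pi SX (w, (s^-1 * h)%g) =
      limit_act (limit_pi SX (w, 1%g)) (s^-1 * h)%g.
    by rewrite limit_act_pi mul1g.
  rewrite alpha_equivariant.
  set t := alpha (limit_pi SX ((fun i => w (n + i)%N), 1%g)).
  have [z [f tE]] := limit_pi_surj t.
  have Kf : K f by apply: FK; right; exact: (tileF _ _ _ (esym tE)).
  have := alpha_transduce tE; rewrite mkv ue -/s => -[z' z'u ->].
  rewrite limit_act_pi -mulgA mulVKg.
  (* Any word ending in [u] would do, so the remaining letters are filled with [point]. *)
  pose w_u : word_space Y := nth point u.
  have w_uu : mkseq w_u n = u by rewrite -un mkseq_nth.
  apply: (inu w_u); first by rewrite /cylinder /= un.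
  by exists f => //=; rewrite /ending w_uu.
(* Cells of level [n] have equal weight on both sides because the alphabets have equal size, so the
   injection [psi] preserves the total. *)
have le_B n : marked_measure R Y G (B n) <= limit_measure R SX (alpha @^-1` U).
  rewrite (marked_measure_cells _ (finI n) (@szI n)) -cardXY.
  apply: (@le_trans _ _
    (marked_measure R X G (\bigcup_(i in psi @` I n) cell i))).
    rewrite (@marked_measure_cells _ _ _ n); last 2 first.
    - exact: finite_image.
    - by move=> _ [i Ii <-] /=; have [-> _] := invP i.1; exact: szI.
    by rewrite fsbig_image// => ? ? _ _; exact: psi_inj.
  apply: le_measure; rewrite ?inE//.
  - apply: fin_bigcup_measurable; first exact: finite_image.
    by move=> i _; exact: measurable_cell.
  - apply: open_marked_measurable => //; apply: open_comp.
      by move=> ? _; exact: limit_pi_continuous.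
    by apply: open_comp => // ? _; exact: alpha_cont.
rewrite limit_measureE UB.
have cvB := @nondecreasing_cvg_mu _ _ _ (marked_measure R Y G) B mB
  (bigcup_measurable (fun n _ => mB n)) ndB.
rewrite -(cvg_lim _ cvB)//; apply: lime_le.
  by apply/cvg_ex; eexists; exact: cvB.
by apply: nearW => n; exact: le_B.
Qed.

End transducer.

(** * The inverse homeomorphism and passage to Borel sets *)

Lemma inverse_limit_tau (G : groupType) (X Y : alphabetType)
    (SX : self_similar_action G X) (SY : self_similar_action G Y)
    (alpha : limit_space SX -> limit_space SY)
    (beta : limit_space SY -> limit_space SX) (x : X) (y : Y) (s : G) t :
    cancel alpha beta -> cancel beta alpha ->
    (forall t g, alpha (limit_act t g) = limit_act (alpha t) g) ->
    (forall t, alpha (limit_tau x t) = limit_act (limit_tau y (alpha t)) s) ->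
  beta (limit_tau y t) = limit_act (limit_tau x (beta t)) s^-1.
Proof.
move=> alphaK betaK equiv tau; apply: (can_inj alphaK).
rewrite betaK equiv tau betaK; have [w [g ->]] := limit_pi_surj (limit_tau y t).
by rewrite (limit_act_pi _ w) limit_act_pi mulgK.
Qed.

(** Two letters with the same image represent the same left coset of [H], so they coincide since [T]
    is a transversal. *)
Lemma transversal_letter (G : groupType) (H : groupClosed G) (X Y : Type)
    (T : X -> G) (T' : Y -> G) :
    left_transversal H T -> left_transversal H T' ->
  exists2 letter : X -> Y, injective letter &
    forall x, (T' (letter x))^-1 * T x \in H.
Proof.
move=> hT hT'.
have /choice[letter letterP] x : exists y, (T' y)^-1 * T x \in H.
  by have [y [yH _]] := hT' (T x); exists y.
exists letter => // x1 x2 e.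
have [x [_ xU]] := hT (T x1).
rewrite -(xU x1) ?mulVg ?gpred1// (xU x2)//.
rewrite -(mulVKg (T' (letter x1)) (T x1)) {1}e mulgA gpredM ?letterP//.
by rewrite -gpredV invgM invgK.
Qed.

Theorem theorem14 (R : realType) (G : groupType)
  (phi : virtual_endomorphism G) (X Y : alphabetType)
  (T C : X -> G) (T' C' : Y -> G)
  (hT : left_transversal (ve_dom phi) T)
  (hT' : left_transversal (ve_dom phi) T')
  (SX : self_similar_action G X) (SY : self_similar_action G Y)
  (hSX : defined_by SX phi T C) (hSY : defined_by SY phi T' C')
  (cSX : contracting SX) (cSY : contracting SY)
  (alpha : limit_space SX -> limit_space SY)
  (alpha_homeo : homeomorphism alpha)
  (alpha_equivariant : forall (t : limit_space SX) (g : G),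
     alpha (limit_act t g) = limit_act (alpha t) g)
  (alpha_tau : forall (t : limit_space SX) (x : X) (y : Y),
     (T' y)^-1 * T x \in ve_dom phi ->
     alpha (limit_tau x t) =
       limit_act (limit_tau y (alpha t))
                 ((C' y)^-1 * phi ((T' y)^-1 * T x) * C x))
  (A : set (borel (limit_space SX))) (mA : measurable A) :
  limit_measure R SY (alpha @` A) = limit_measure R SX A.
Proof.
have [alpha_cont [beta [beta_cont alphaK betaK]]] := alpha_homeo.
have beta_equivariant t g : beta (limit_act t g) = limit_act (beta t) g.
  by apply: (can_inj alphaK); rewrite alpha_equivariant !betaK.
have [f f_inj fP] := transversal_letter hT hT'.
have [h h_inj hP] := transversal_letter hT' hT.
have cardXY : #|X| = #|Y|.
  by apply/eqP; rewrite eqn_leq (leq_card f)// (leq_card h).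
(* Rewriting images under [alpha] as preimages under [beta] turns the left-hand side into a
   push-forward measure. *)
have imageE B : alpha @` B = beta @^-1` B.
  apply/seteqP; split => [_ [t Bt <-]|t Bt].
    by rewrite /preimage/= alphaK.
  by exists (beta t).
pose s x y := (C' y)^-1 * phi ((T' y)^-1 * T x) * C x.
have le_XY (U : set (limit_space SY)) : open U ->
    (limit_measure R SY U <= limit_measure R SX (alpha @^-1` U))%E.
  move=> oU; apply: (le_limit_measure_open (letter := f)
    (shift := fun x => s x (f x))) => // t x.
  exact: alpha_tau.
have le_YX (U : set (limit_space SX)) : open U ->
    (limit_measure R SX U <= limit_measure R SY (beta @^-1` U))%E.
  move=> oU; apply: (le_limit_measure_open (letter := h)
    (shift := fun y => (s (h y) y)^-1)) => // t y.
  apply: inverse_limit_tau alphaK betaK alpha_equivariant _ => t'.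
  by apply: alpha_tau; rewrite -gpredV invgM invgK.
have mbeta : measurable_fun setT
    (beta \o limit_pi SY : marked_measurable Y G -> borel (limit_space SX)).
  apply: (@measurability _ _ _ _ _ _
    (@open (limit_space SX) : set (set (borel (limit_space SX))))) => //.
  move=> _ [U oU <-]; rewrite setTI.
  apply: open_marked_measurable; first exact: (contracting_countable cSY).
  apply: (@open_comp _ _ (limit_pi SY) (beta @^-1` U)).
    by move=> ? _; exact: limit_pi_continuous.
  by apply: open_comp => // ? _; exact: beta_cont.
have [m1 m1E] : exists m : {measure set (borel (limit_space SX)) -> \bar R}%R,
    forall B, m B = limit_measure R SX B.
  unshelve (exists (pushforward (marked_measure R X G)
    (limit_pi SX : _ -> borel (limit_space SX)))) => //.
  exact: measurable_limit_pi.
have [m2 m2E] : exists m : {measure set (borel (limit_space SX)) -> \bar R}%R,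
    forall B, m B = limit_measure R SY (beta @^-1` B).
  by unshelve (exists (pushforward (marked_measure R Y G)
    (beta \o limit_pi SY : _ -> borel (limit_space SX)))).
have [F [finF ndF FT]] := labelled_exhaustion cSX.
rewrite imageE -m1E -m2E; apply/esym.
(* Open sets form a generating system closed under intersection, and the sets [labelled (F n)]
   exhaust the space with finite measure. *)
apply: (@measure_unique _ _ (borel (limit_space SX))
  (open : set (set (limit_space SX))) (fun n => @labelled _ _ SX (F n))) => //.
- by move=> U V; exact: openI.
- by move=> n; exact: open_labelled.
- by apply/seteqP; split => // t _; have [n nt] := FT t; exists n.
- move=> U oU; rewrite m1E m2E; apply/eqP; rewrite eq_le le_YX//=.
  rewrite (le_trans (le_XY _ _))//.
    by apply: open_comp => // ? _; exact: beta_cont.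
  by rewrite -comp_preimage (_ : beta \o alpha = id)//; apply/funext.
- by move=> n; rewrite m1E; exact: limit_measure_labelled.
Qed.
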